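(* Let $G$ and $H$ be arbitrary connected non-trivial graphs. Then $tn(G\Box H)=2$.
   Context: All graphs are finite, undirected, without loops or multiple edges; a graph is non-trivial if it has at least two vertices. The Cartesian product $G\Box H$ has vertex set $V(G)\times V(H)$, and $(g_1,h_1)$, $(g_2,h_2)$ are adjacent when ($g_1g_2\in E(G)$ and $h_1=h_2$) or ($g_1=g_2$ and $h_1h_2\in E(H)$). For distinct non-adjacent vertices $u,v$ of a graph $F$, a tolled walk between $u$ and $v$ is a sequence of vertices $u,w_1,\ldots,w_k,v$ with $k\ge 1$ such that $w_iw_{i+1}\in E(F)$ for all $1\le i<k$, $uw_i\in E(F)$ if and only if $i=1$, and $vw_i\in E(F)$ if and only if $i=k$. If $uv\in E(F)$, the only tolled walk between $u$ and $v$ is $u,v$; the only tolled walk from $v$ to $v$ is $v$ itself. The toll interval $T_F(u,v)$ is the set of all vertices lying on some tolled walk between $u$ and $v$. A set $S\subseteq V(F)$ is a toll set of $F$ if $\bigcup_{u,v\in S}T_F(u,v)=V(F)$. The toll number $tn(F)$ is the minimum size of a toll set of $F$. *)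

(* Defs.v *)
From mathcomp Require Import all_boot.
From mathcomp Require Import boolp.

Set Implicit Arguments.
Unset Strict Implicit.
Unset Printing Implicit Defensive.

Record sgraph := SGraph {
  svertex :> finType;
  sedge : rel svertex;
  sedge_sym : symmetric sedge;
  sedge_irrefl : irreflexive sedge }.

Definition nontrivial (G : sgraph) : Prop := 1 < #|G|.

Definition connected_graph (G : sgraph) : Prop :=
  forall x y : G, connect (@sedge G) x y.

Section CartesianProduct.
Variables G H : sgraph.

Definition cart_rel : rel (G * H) := fun p q =>
  (sedge p.1 q.1 && (p.2 == q.2)) || ((p.1 == q.1) && sedge p.2 q.2).

Lemma cart_sym : symmetric cart_rel.
Proof.
move=> p q; rewrite /cart_rel (sedge_sym p.1) (sedge_sym p.2).
by rewrite (eq_sym p.1) (eq_sym p.2).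
Qed.

Lemma cart_irrefl : irreflexive cart_rel.
Proof. by move=> p; rewrite /cart_rel !sedge_irrefl andbF. Qed.

Definition cartesian_product : sgraph := SGraph cart_sym cart_irrefl.

End CartesianProduct.

Section Toll.
Variable F : sgraph.
Implicit Types (u v x : F) (s w : seq F) (S : {set F}).

(* [w] lists the inner vertices w_1, ..., w_k, so w_(i+1) is [nth u w i];
   the default value [u] is irrelevant since [i < size w]. *)
Definition inner_tolled u v w : Prop :=
  [/\ 0 < size w,
      sorted (@sedge F) w
    & forall i, i < size w ->
        (sedge u (nth u w i) <-> i = 0) /\
        (sedge v (nth u w i) <-> i.+1 = size w)].

(* [s] is the full vertex sequence of the walk, endpoints included. *)
Definition tolled_walk u v s : Prop :=
  if u == v then s = [:: u]
  else if sedge u v then s = [:: u; v]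
  else exists2 w, s = u :: rcons w v & inner_tolled u v w.

Definition toll_interval u v : {set F} :=
  [set x | `[< exists2 s, tolled_walk u v s & x \in s >]].

Definition toll_set S : bool :=
  \bigcup_(u in S) \bigcup_(v in S) toll_interval u v == [set: F].

Lemma toll_setT : toll_set [set: F].
Proof.
apply/eqP/setP => x; rewrite inE; apply/bigcupP; exists x => //.
apply/bigcupP; exists x => //; rewrite inE; apply/asboolP.
by exists [:: x]; rewrite ?inE // /tolled_walk eqxx.
Qed.

(* By [toll_setT], this minimum ranges over a nonempty family. *)
Definition toll_number : nat :=
  #|[arg min_(S < [set: F] | toll_set S) #|S| ]|.

Lemma toll_numberP n :
  toll_number = n <->
  (exists2 S, toll_set S & #|S| = n) /\ (forall S, toll_set S -> n <= #|S|).
Proof.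
rewrite /toll_number; case: arg_minnP => [|S tS minS]; first exact: toll_setT.
split=> [<-|[[S' tS' <-] minS']]; first by split=> //; exists S.
by apply/eqP; rewrite eqn_leq minS //= minS'.
Qed.

End Toll.

(* Main.v *)
Require Import Defs.
From mathcomp Require Import all_boot.
From mathcomp Require Import boolp.

(** For two distinct non-adjacent vertices [u] and [v], a vertex [x] lies in the
    toll interval of [u] and [v] as soon as [x] has a walk to [v] that, after
    its first vertex, stays out of the closed neighbourhood N[u], and likewise
    a walk to [u] staying out of N[v] ([toll_interval_avoiding]): stop each
    walk at its first neighbour of its target, and glue the two pieces at [x].

    In the product take [u = (g1, h1)] and [v = (g2, h2)], where [g1 <> g2] are
    non-cut vertices of G and [h1 <> h2] are non-cut vertices of H; a non-trivial
    connected graph always has two of them ([two_non_cut]).  All of N[u] lies in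
    the row and the column through [u].  Outside that cross, the graph is the
    product of the connected graphs G - g1 and H - h1, hence connected, and it
    contains [v].  A vertex [x <> u] on the cross leaves it in one step, by
    moving along the other factor.  So every [x <> u] reaches [v] while avoiding
    N[u] ([cart_connect_avoiding]); exchanging [u] and [v] gives the other walk,
    and [{u, v}] is a toll set.  A single vertex is not a toll set, because its
    toll interval with itself is a singleton. *)

Set Implicit Arguments.
Unset Strict Implicit.
Unset Printing Implicit Defensive.

(** The first vertex of a step is unconstrained: a walk for this relation may
    start at a neighbour of [u], as the walk from the first inner vertex of a
    tolled walk does. *)
Definition avoiding (F : sgraph) (u : F) : rel F :=
  [rel y z | [&& sedge y z, z != u & ~~ sedge u z]].

(** Cutting the walk at the first neighbour of [v] leaves a walk [x :: p] on
    which only the last vertex is adjacent to [v]. *)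
Lemma cut_avoiding_walk (F : sgraph) (u v x : F) :
    x != v -> connect (avoiding u) x v ->
  exists p, [/\ path (@sedge F) x p, all (fun z => ~~ sedge u z) p,
    sedge v (last x p) & all (fun z => ~~ sedge v z) (belast x p)].
Proof.
move=> xNv /connectP[p]; elim: p x xNv => [|y p IHp] x xNv /=.
  by move=> _ vx; rewrite vx eqxx in xNv.
case/andP=> /and3P[xy _ uNy] yp vE.
have [vx|vNx] := boolP (sedge v x); first by exists [::].
have yNv: y != v by apply: contraNneq vNx => <-; rewrite sedge_sym.
have [q [yq uq vq vNq]] := IHp y yNv yp vE.
by exists (y :: q); rewrite /= xy uNy vNx.
Qed.

Lemma toll_interval_avoiding (F : sgraph) (u v x : F) :
    u != v -> ~~ sedge u v -> x != u -> x != v ->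
    connect (avoiding u) x v -> connect (avoiding v) x u ->
  x \in toll_interval u v.
Proof.
move=> uNv uNv_edge xNu xNv xv xu.
have [p [xp up vp vNp]] := cut_avoiding_walk xNv xv.
have [q [xq vq uq uNq]] := cut_avoiding_walk xNu xu.
rewrite inE; apply/asboolP.
(* The inner vertices are split at the first one for adjacency to [u], and at
   the last one for adjacency to [v]. *)
have w_head: rev q ++ x :: p = last x q :: rev (belast x q) ++ p.
  by rewrite -cat_rcons -rev_cons lastI rev_rcons.
have w_last: rev q ++ x :: p = rcons (rev q ++ belast x p) (last x p).
  by rewrite lastI rcons_cat.
exists (u :: rcons (rev q ++ x :: p) v); last first.
  by rewrite inE mem_rcons inE mem_cat inE eqxx !orbT.
rewrite /tolled_walk (negPf uNv) (negPf uNv_edge).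
exists (rev q ++ x :: p) => //; split.
- by rewrite w_head.
- rewrite sorted_cat_cons xp andbT -rev_cons rev_sorted /=.
  by rewrite (eq_path (e' := @sedge F)) // => y z; rewrite /= sedge_sym.
- move=> i i_lt; split.
    move: i_lt; rewrite w_head; case: i => [|i] //= i_lt.
    have /allP/(_ _ (mem_nth u i_lt)): all (fun z => ~~ sedge u z)
        (rev (belast x q) ++ p) by rewrite all_cat all_rev uNq.
    by move=> /negPf ->.
  move: i_lt; rewrite w_last size_rcons ltnS nth_rcons leq_eqVlt.
  case/predU1P=> [->|i_lt]; first by rewrite ltnn eqxx vp.
  rewrite i_lt.
  have /allP/(_ _ (mem_nth u i_lt)): all (fun z => ~~ sedge v z)
      (rev q ++ belast x p) by rewrite all_cat all_rev vq.
  by move=> /negPf ->; split=> // -[iE]; rewrite iE ltnn in i_lt.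
Qed.

Lemma toll_interval_refl (F : sgraph) (u : F) : toll_interval u u = [set u].
Proof.
apply/setP => x; rewrite !inE; apply/asboolP/eqP.
  by case=> s; rewrite /tolled_walk eqxx => ->; rewrite inE => /eqP.
by move=> ->; exists [:: u]; rewrite ?inE // /tolled_walk eqxx.
Qed.

Lemma toll_set_ge2 (F : sgraph) (S : {set F}) :
  nontrivial F -> toll_set S -> 2 <= #|S|.
Proof.
move=> ntF /eqP tS; rewrite ltnNge leq_eqVlt ltnS leqn0.
apply/negP => /orP[/cards1P[u Su]|/eqP/cards0_eq S0].
  move: tS; rewrite Su !big_set1 toll_interval_refl => uT.
  by move: ntF; rewrite /nontrivial -cardsT -uT cards1.
move: tS; rewrite S0 big_set0 => T0.
by move: ntF; rewrite /nontrivial -cardsT -T0 cards0.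
Qed.

Definition induced (G : sgraph) (A : {set G}) : rel G :=
  [rel x y | [&& sedge x y, x \in A & y \in A]].

Lemma induced_connect_sym (G : sgraph) (A : {set G}) :
  connect_sym (induced A).
Proof.
by apply: sym_connect_sym => x y; rewrite /induced /= sedge_sym [(x \in A) && _]andbC.
Qed.

Definition non_cut (G : sgraph) (g : G) : Prop :=
  forall x y, x != g -> y != g -> connect (induced [set~ g]) x y.

(** Among the proper vertex sets that contain [r] and induce a connected
    subgraph, a maximal one misses exactly one vertex: some edge leaves it, and
    adding the outer end of that edge keeps it connected. *)
Lemma exists_non_cut (G : sgraph) (r : G) :
  connected_graph G -> nontrivial G -> exists2 g, g != r & non_cut g.
Proof.
move=> connG ntG.
pose P (S : {set G}) := [&& r \in S, S != [set: G] &
  [forall x in S, connect (induced S) r x]].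
have Pr: P [set r].
  rewrite /P set11 /=; apply/andP; split.
    by apply: contraTneq ntG => rT; rewrite /nontrivial -cardsT -rT cards1.
  by apply/forall_inP => x /set1P ->.
have [S /maxsetP[/and3P[rS SNT /forall_inP rootS] maxS] _] := maxset_exists Pr.
have [x [y [xS yNS xy]]]: exists x y, [/\ x \in S, y \notin S & sedge x y].
  apply/not_existsP => noedge.
  have closedS: closed (@sedge G) S.
    have stable x y: sedge x y -> x \in S -> y \in S.
      move=> xy xS; apply/negP => /negP yNS.
      by apply: (noedge x); exists y.
    move=> x y xy; apply/idP/idP; first exact: stable.
    by apply: stable; rewrite sedge_sym.
  case/negP: SNT; apply/eqP/setP => z; rewrite inE.
  by rewrite -(closed_connect closedS (connG r z)).
have sub z t: connect (induced S) z t -> connect (induced (y |: S)) z t.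
  apply: connect_sub => {z t} z t /and3P[zt zS tS].
  by apply: connect1; rewrite /induced /= zt !inE zS tS !orbT.
have rootyS: [forall z in y |: S, connect (induced (y |: S)) r z].
  apply/forall_inP => z /setU1P[->|zS]; last exact/sub/rootS.
  apply: connect_trans (sub _ _ (rootS x xS)) _; apply: connect1.
  by rewrite /induced /= xy !inE xS eqxx orbT.
have ySE: y |: S = [set: G].
  apply: contraNeq yNS => ySNT; rewrite -(maxS (y |: S)) ?setU11 ?subsetU1 //.
  by rewrite /P ySNT rootyS !inE rS orbT.
have SE: S = [set~ y].
  apply/setP => z; have /setP/(_ z) := ySE; rewrite !inE.
  by case: eqVneq => [->|//] _; apply: negPf.
exists y; first by apply: contraNneq yNS => ->.
move=> z t zNy tNy; rewrite -SE.
apply: (@connect_trans _ _ r); last by apply: rootS; rewrite SE !inE.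
by rewrite induced_connect_sym; apply: rootS; rewrite SE !inE.
Qed.

Lemma two_non_cut (G : sgraph) :
    connected_graph G -> nontrivial G ->
  exists g1 g2 : G, [/\ g1 != g2, non_cut g1 & non_cut g2].
Proof.
move=> connG ntG; have /card_gt0P[r _]: 0 < #|G| by apply: ltnW.
have [g1 _ cut1] := exists_non_cut r connG ntG.
have [g2 g2N1 cut2] := exists_non_cut g1 connG ntG.
by exists g1, g2; rewrite eq_sym.
Qed.

Lemma exists_neighbour (G : sgraph) (x y : G) :
  connected_graph G -> x != y -> exists z, sedge x z.
Proof.
move=> connG xNy; have /connectP[[|z p] /=] := connG x y.
  by move=> _ yx; rewrite yx eqxx in xNy.
by case/andP=> xz _ _; exists z.
Qed.

Lemma connect_morph (T T' : finType) (e : rel T) (e' : rel T') (f : T -> T') :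
    (forall x y, e x y -> e' (f x) (f y)) ->
  forall x y, connect e x y -> connect e' (f x) (f y).
Proof.
move=> ef x y /connectP[p xp ->]; elim: p x xp => [|z p IHp] x //=.
case/andP=> xz zp; exact: connect_trans (connect1 (ef _ _ xz)) (IHp _ zp).
Qed.

Section CartesianAvoiding.
Variables (G H : sgraph) (g : G) (h : H).
Let F := cartesian_product G H.
Let u : F := (g, h).

Lemma cart_avoiding_off_cross (x y : F) :
  sedge x y -> y.1 != g -> y.2 != h -> avoiding u x y.
Proof.
move=> xy yg yh; rewrite /avoiding /= [cart_rel x y]xy /=.
rewrite /cart_rel /= [g == _]eq_sym [h == _]eq_sym (negPf yg) (negPf yh) andbF.
by rewrite andbT; apply: contraNneq yg => ->.
Qed.

(** Vertices off the cross through [u] form the product of G - g and H - h: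
    walk in the first factor, then in the second. *)
Lemma cart_connect_off_cross (x v : F) :
    non_cut g -> non_cut h -> x.1 != g -> x.2 != h -> v.1 != g -> v.2 != h ->
  connect (avoiding u) x v.
Proof.
case: x v => [x1 x2] [v1 v2] /= cutg cuth x1g x2h v1g v2h.
apply: (@connect_trans _ _ (v1, x2)).
  apply: (@connect_morph _ _ (induced [set~ g]) _ (pair^~ x2)) (cutg _ _ x1g v1g).
  move=> a b /and3P[ab _]; rewrite !inE => bg.
  by apply: cart_avoiding_off_cross => //=; rewrite /cart_rel /= ab eqxx.
apply: (@connect_morph _ _ (induced [set~ h]) _ (pair v1)) (cuth _ _ x2h v2h).
move=> a b /and3P[ab _]; rewrite !inE => bh.
by apply: cart_avoiding_off_cross => //=; rewrite /cart_rel /= ab eqxx orbT.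
Qed.

(** On the cross only [u] itself lies in both the row and the column, so any
    other vertex of the cross leaves it with one step in the factor where it
    agrees with [u]; this works whether or not it is a neighbour of [u]. *)
Lemma cart_connect_avoiding (x v : F) :
    connected_graph G -> connected_graph H -> non_cut g -> non_cut h ->
    v.1 != g -> v.2 != h -> x != u ->
  connect (avoiding u) x v.
Proof.
move=> connG connH cutg cuth vg vh xNu.
have irr (K : sgraph) (a b : K) : sedge a b -> b != a.
  by apply: contraTneq => ->; rewrite sedge_irrefl.
have step (y : F) : sedge x y -> y.1 != g -> y.2 != h ->
    connect (avoiding u) x v.
  move=> xy yg yh; apply: connect_trans (cart_connect_off_cross _ _ yg yh _ _) => //.
  exact/connect1/cart_avoiding_off_cross.
case: x xNu step => x1 x2 xNu step.
have [x1E|x1g] := eqVneq x1 g; have [x2E|x2h] := eqVneq x2 h.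
- by rewrite x1E x2E eqxx in xNu.
- have [z gz] := exists_neighbour connG (etrans (congr1 negb (eq_sym _ _)) vg).
  by apply: (step (z, x2)) => //=; rewrite ?irr // /cart_rel /= x1E gz eqxx.
- have [z hz] := exists_neighbour connH (etrans (congr1 negb (eq_sym _ _)) vh).
  by apply: (step (x1, z)) => //=; rewrite ?irr // /cart_rel /= x2E hz eqxx orbT.
- exact: cart_connect_off_cross.
Qed.

End CartesianAvoiding.

Theorem corollary3p9 (G H : sgraph)
    (connG : connected_graph G) (ntG : nontrivial G)
    (connH : connected_graph H) (ntH : nontrivial H) :
  toll_number (cartesian_product G H) = 2.
Proof.
have [g1 [g2 [gN cutg1 cutg2]]] := two_non_cut connG ntG.
have [h1 [h2 [hN cuth1 cuth2]]] := two_non_cut connH ntH.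
set F := cartesian_product G H.
pose u : F := (g1, h1); pose v : F := (g2, h2).
have uNv: u != v by rewrite /u /v xpair_eqE negb_and gN.
have ntF: nontrivial F.
  by apply: leq_trans (max_card [set u; v]); rewrite cards2 uNv.
apply/toll_numberP; split; last by move=> S; apply: toll_set_ge2.
exists [set u; v]; last by rewrite cards2 uNv.
apply/eqP/setP => x; rewrite inE.
have in_interval a b : a \in [set u; v] -> b \in [set u; v] ->
    x \in toll_interval a b ->
    x \in \bigcup_(a in [set u; v]) \bigcup_(b in [set u; v]) toll_interval a b.
  by move=> aS bS xab; apply/bigcupP; exists a => //; apply/bigcupP; exists b.
have [xu|xNu] := eqVneq x u.
  by apply: (in_interval u u); rewrite ?set21 // toll_interval_refl xu set11.
have [xv|xNv] := eqVneq x v.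
  by apply: (in_interval v v); rewrite ?set22 // toll_interval_refl xv set11.
apply: (in_interval u v); rewrite ?set21 ?set22 //.
apply: toll_interval_avoiding => //.
- by rewrite /= /cart_rel /= (negPf gN) (negPf hN) andbF.
- by apply: cart_connect_avoiding => //=; rewrite eq_sym.
- exact: cart_connect_avoiding.
Qed.
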